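(* Let $(\mathcal{A},[\cdot,\cdot],N)$ be an $S$-adjoint-admissible Nijenhuis mock-Lie algebra, where $S:\mathcal{A}\to\mathcal{A}$ is a linear map, and let $r\in\mathcal{A}\otimes\mathcal{A}$ be an antisymmetric solution of the $S$-admissible mock-Lie-Yang-Baxter equation in $(\mathcal{A},[\cdot,\cdot],N)$. Then $(\mathcal{A},[\cdot,\cdot],\Delta,N,S)$ is a coboundary Nijenhuis mock-Lie bialgebra, where $\Delta=\Delta_r$ is defined, for $r=\sum_ia_i\otimes b_i$, by $$\Delta_r(x)=\sum_i[x,a_i]\otimes b_i-a_i\otimes[x,b_i],\qquad x\in\mathcal{A}.$$
   Context: All vector spaces are over a field $K$ of characteristic zero. A mock-Lie algebra is a vector space with a commutative bilinear map $[\cdot,\cdot]$ such that $[x,[y,z]]+[y,[z,x]]+[z,[x,y]]=0$. A Nijenhuis mock-Lie algebra $(\mathcal{A},[\cdot,\cdot],N)$ is a mock-Lie algebra with a linear map $N$ such that $[N(x),N(y)]+N^2([x,y])=N([N(x),y])+N([x,N(y)])$. It is $S$-adjoint-admissible if $S([N(x),y])+[x,S^2(y)]=[N(x),S(y)]+S([x,S(y)])$ for all $x,y$. For $r=\sum_ia_i\otimes b_i$, the $S$-admissible mock-Lie-Yang-Baxter equation in $(\mathcal{A},[\cdot,\cdot],N)$ is the system $$\sum_{i,j}\bigl([a_i,a_j]\otimes b_i\otimes b_j+a_i\otimes a_j\otimes[b_i,b_j]-a_i\otimes[b_i,a_j]\otimes b_j\bigr)=0,\quad(N\otimes\mathrm{id}-\mathrm{id}\otimes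 S)(r)=0,\quad(S\otimes\mathrm{id}-\mathrm{id}\otimes N)(r)=0.$$ $r$ is antisymmetric if $r=-\tau(r)$, $\tau$ the flip. A mock-Lie coalgebra $(\mathcal{A},\Delta)$, $\Delta(x)=x_{(1)}\otimes x_{(2)}$, satisfies $x_{(1)}\otimes x_{(2)}=x_{(2)}\otimes x_{(1)}$ and $x_{(1)}\otimes x_{(2)(1)}\otimes x_{(2)(2)}+x_{(1)(1)}\otimes x_{(1)(2)}\otimes x_{(2)}+x_{(2)(1)}\otimes x_{(1)}\otimes x_{(2)(2)}=0$. A mock-Lie bialgebra is a mock-Lie algebra and mock-Lie coalgebra with $\Delta([x,y])=-[x,y_{(1)}]\otimes y_{(2)}-y_{(1)}\otimes[x,y_{(2)}]-[y,x_{(1)}]\otimes x_{(2)}-x_{(1)}\otimes[y,x_{(2)}]$. A Nijenhuis mock-Lie coalgebra $(\mathcal{A},\Delta,S)$ is a mock-Lie coalgebra with a linear map $S$ such that $(S\otimes S)\Delta+\Delta S^2=(S\otimes\mathrm{id})\Delta S+(\mathrm{id}\otimes S)\Delta S$. A Nijenhuis mock-Lie bialgebra $(\mathcal{A},[\cdot,\cdot],\Delta,N,S)$ consists of a mock-Lie bialgebra $(\mathcal{A},[\cdot,\cdot],\Delta)$ such that $(\mathcal{A},[\cdot,\cdot],N)$ is an $S$-adjoint-admissible Nijenhuis mock-Lie algebra, $(\mathcal{A},\Delta,S)$ is a Nijenhuis mock-Lie coalgebra, and $(S\otimes\mathrm{id})\Delta N+(\mathrm{id}\otimes N^2)\Delta=(S\otimes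 N)\Delta+(\mathrm{id}\otimes N)\Delta N$. It is coboundary if $\Delta=\Delta_r$ for some $r\in\mathcal{A}\otimes\mathcal{A}$. *)

(* Defs.v *)
From HB Require Import structures.
From mathcomp Require Import all_boot all_order all_algebra.
From mathcomp Require Import sesquilinear boolp.
From mathcomp Require Import freeg.

Set Implicit Arguments.
Unset Strict Implicit.
Unset Printing Implicit Defensive.

Import GRing.Theory.
Import Quotient.
Local Open Scope ring_scope.
Local Open Scope quotient_scope.

Reserved Notation "x ⊗ y" (at level 38, right associativity).
Reserved Notation "'\tsum_' ( a ⊗ b '<-' t ) E"
  (at level 41, a name, b name, t at level 200, E at level 41, right associativity,
   format "'\tsum_' ( a  ⊗  b  '<-'  t )  E").

(* The tensor product V ⊗ W of possibly infinite-dimensional vector spaces: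
   the free vector space on V * W modulo the subspace [tensor_rel]
   spanned by the bilinearity relations. *)
Section Tensor.
Variables (K : fieldType) (V W : lmodType K).

Let free := {freeg (V * W)%type / K}.

Inductive tensor_rel : free -> Prop :=
| tensor_rel0 : tensor_rel 0
| tensor_relD x y of tensor_rel x & tensor_rel y : tensor_rel (x + y)
| tensor_relZ (a : K) x of tensor_rel x : tensor_rel (a *: x)
| tensor_rell (a : K) v v' w :
    tensor_rel (<< (a *: v + v', w) >> - (a *: << (v, w) >> + << (v', w) >>))
| tensor_relr (a : K) v w w' :
    tensor_rel (<< (v, a *: w + w') >> - (a *: << (v, w) >> + << (v, w') >>)).

Definition tensor_relb : {pred free} := fun x => `[< tensor_rel x >].

Fact tensor_relb_zmod : zmod_closed tensor_relb.
Proof.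
split=> [|x y]; first by apply/asboolP; constructor.
move=> /asboolP Hx /asboolP Hy; apply/asboolP.
by rewrite -scaleN1r; apply: tensor_relD => //; apply: tensor_relZ.
Qed.

HB.instance Definition _ := GRing.isZmodClosed.Build free tensor_relb
  tensor_relb_zmod.

Definition tensor := Quotient.quot (tensor_relb : zmodClosed free).

HB.instance Definition _ := GRing.Zmodule.copy tensor
  (Quotient.quot (tensor_relb : zmodClosed free)).

Definition tscale (a : K) (t : tensor) : tensor := \pi_tensor (a *: repr t).

Lemma tensor_pi_eq (x y : free) :
  \pi_tensor x = \pi_tensor y <-> tensor_rel (x - y).
Proof.
have E := idealrBE (tensor_relb : zmodClosed free) x y.
split=> H.
  by apply/asboolP; change (x - y \in tensor_relb); rewrite E; apply/eqP.
by apply/eqP; rewrite -E; apply/asboolP.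
Qed.

Lemma tensor_piD (x y : free) :
  \pi_tensor (x + y) = \pi_tensor x + \pi_tensor y.
Proof. exact: (@pi_add free (tensor_relb : zmodClosed free)). Qed.

Lemma tensor_piZ (a : K) (x : free) :
  \pi_tensor (a *: x) = tscale a (\pi_tensor x).
Proof.
apply/tensor_pi_eq; rewrite -scalerBr; apply: tensor_relZ.
by apply/tensor_pi_eq; rewrite reprK.
Qed.

Fact tscaleA a b t : tscale a (tscale b t) = tscale (a * b) t.
Proof. by rewrite -[t]reprK -(tensor_piZ b) -!tensor_piZ scalerA. Qed.

Fact tscale1 : left_id 1 tscale.
Proof. by move=> t; rewrite -[t]reprK -tensor_piZ scale1r. Qed.

Fact tscaleDr : right_distributive tscale +%R.
Proof.
by move=> a s t; rewrite -[s]reprK -[t]reprK -tensor_piD -!tensor_piZ scalerDr tensor_piD.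
Qed.

Fact tscaleDl t : {morph tscale^~ t : a b / a + b}.
Proof. by move=> a b; rewrite -[t]reprK -!tensor_piZ scalerDl tensor_piD. Qed.

HB.instance Definition _ := GRing.Zmodule_isLmodule.Build K tensor
  tscaleA tscale1 tscaleDr tscaleDl.

Lemma tensor_pi_linear : linear (\pi_tensor : free -> tensor).
Proof. by move=> a x y; rewrite tensor_piD tensor_piZ. Qed.

Definition tpure (v : V) (w : W) : tensor := \pi_tensor << (v, w) >>.

(* For a bilinear f, the linear map on V ⊗ W sending v ⊗ w to f v w
   (see [tlift_pure], [tlift_linear]); meaningless for other f. *)
Definition tlift (U : lmodType K) (f : V -> W -> U) (t : tensor) : U :=
  fglift (fun p => f p.1 p.2) (repr t).

End Tensor.

Arguments tscale : simpl never.
Arguments tpure : simpl never.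
Arguments tlift : simpl never.

Notation "V ⊗ W" := (tensor V W) : type_scope.
Notation "v ⊗ w" := (tpure v w) : ring_scope.
Notation "'\tsum_' ( a ⊗ b '<-' t ) E" := (tlift (fun a b => E) t) : ring_scope.

Section TensorTheory.
Variables (K : fieldType) (V W : lmodType K).

Lemma fglift_linear (X : choiceType) (U : lmodType K) (f : X -> U) :
  linear (fglift f : {freeg X / K} -> U).
Proof.
have B := lift_is_additive f.
have Z0 : fglift f 0 = 0 by rewrite -(subrr 0) B subrr.
have N x : fglift f (- x) = - fglift f x by rewrite -sub0r B Z0 sub0r.
have D x y : fglift f (x + y) = fglift f x + fglift f y.
  by rewrite -{1}[y]opprK B N opprK.
have S (I : Type) (r : seq I) (F : I -> {freeg X / K}) :
    fglift f (\sum_(i <- r) F i) = \sum_(i <- r) fglift f (F i).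
  by elim/big_rec2: _ => [//|i a b _ <-]; rewrite D.
move=> a x y; rewrite D; congr (_ + _).
rewrite -{2}[x]freeg_sumE S scaler_sumr [a *: x]/GRing.scale /= /fgscale S.
by apply: eq_bigr => i _; rewrite !liftU scalerA.
Qed.

Lemma tpure_bilinear :
  bilinear_for *:%R *:%R (@tpure K V W).
Proof.
split=> [w a v v'|v a w w']; rewrite -tensor_pi_linear;
  apply/tensor_pi_eq; [exact: tensor_rell|exact: tensor_relr].
Qed.

HB.instance Definition _ :=
  bilinear_isBilinear.Build K V W (V ⊗ W)%type *:%R *:%R (@tpure K V W)
    tpure_bilinear.

Section Lift.
Variables (U : lmodType K) (f : V -> W -> U).
Hypothesis f_bilinear : bilinear_for *:%R *:%R f.

Lemma tlift_pi (x : {freeg (V * W)%type / K}) :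
  tlift f (\pi_(tensor V W) x) = fglift (fun p => f p.1 p.2) x.
Proof.
rewrite /tlift; set g := fun p => _; have L := fglift_linear g.
pose h : {linear _ -> _} := HB.pack (fglift g : {freeg (V * W)%type / K} -> U)
  (GRing.isLinear.Build _ _ _ _ _ L).
have hU p : h << p >> = g p by rewrite /= liftU scale1r.
suff H y : tensor_rel y -> h y = 0.
  by apply/eqP; rewrite -subr_eq0 -(linearB h); apply/eqP/H/tensor_pi_eq; rewrite reprK.
elim=> [|a b _ IHa _ IHb|a b _ IH|a v v' w|a v w w'].
- exact: linear0.
- by rewrite linearD IHa IHb addr0.
- by rewrite linearZZ IH scaler0.
- by rewrite linearB linearP !hU /g /= f_bilinear.1 subrr.
- by rewrite linearB linearP !hU /g /= f_bilinear.2 subrr.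
Qed.

Lemma tlift_pure v w : tlift f (v ⊗ w) = f v w.
Proof. by rewrite tlift_pi liftU scale1r. Qed.

Lemma tlift_linear : linear (tlift f).
Proof.
move=> a s t; rewrite -[s]reprK -[t]reprK -tensor_pi_linear !tlift_pi.
exact: fglift_linear.
Qed.

Lemma tlift_sum (I : Type) (r : seq I) (v : I -> V) (w : I -> W) :
  tlift f (\sum_(i <- r) v i ⊗ w i) = \sum_(i <- r) f (v i) (w i).
Proof.
pose h : {linear _ -> _} :=
  HB.pack (tlift f) (GRing.isLinear.Build _ _ _ _ _ tlift_linear).
by rewrite -[LHS]/(h _) linear_sum; apply: eq_bigr => i _; exact: tlift_pure.
Qed.

End Lift.

Lemma tensor_sum (t : V ⊗ W) :
  exists s : seq (V * W), t = \sum_(p <- s) p.1 ⊗ p.2.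
Proof.
pose h : {linear {freeg (V * W)%type / K} -> (V ⊗ W)%type} :=
  HB.pack (\pi_(tensor V W)) (GRing.isLinear.Build _ _ _ _ _ (@tensor_pi_linear K V W)).
exists [seq (coeff p (repr t) *: p.1, p.2) | p <- dom (repr t)].
rewrite big_map -{1}[t]reprK -{1}[repr t]freeg_sumE -[LHS]/(h _) linear_sum.
apply: eq_bigr => -[v w] _ /=; rewrite linearZl_LR -[RHS]/(_ *: h _) -linearZ.
congr (h _); apply/eqP/freeg_eqP => q.
by rewrite coeffZ !coeffU mul1r.
Qed.

(* Linearity in f; no bilinearity of f or g is needed. *)
Lemma tliftP (U : lmodType K) (f g : V -> W -> U) (a : K) (t : V ⊗ W) :
  tlift (fun v w => a *: f v w + g v w) t = a *: tlift f t + tlift g t.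
Proof.
rewrite /tlift -[repr t]freeg_sumE.
elim: (dom _) => [|p s IH].
  rewrite !big_nil -[0]/([freeg [::]] : {freeg (V * W)%type / K}).
  by rewrite !fglift_Freeg !prelift_nil scaler0 addr0.
have D h : fglift h (<< coeff p (repr t) *g p >> +
    \sum_(j <- s) << coeff j (repr t) *g j >>) = 
    coeff p (repr t) *: h p + fglift h (\sum_(j <- s) << coeff j (repr t) *g j >>) :> U.
  by rewrite -[X in X + _]scale1r fglift_linear scale1r liftU.
by rewrite !big_cons !D IH !scalerDr !scalerA mulrC addrACA.
Qed.

End TensorTheory.

Definition tmap (K : fieldType) (V V' W W' : lmodType K)
    (f : V -> V') (g : W -> W') (t : V ⊗ W) : V' ⊗ W' :=
  \tsum_(v ⊗ w <- t) f v ⊗ g w.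

Definition tflip (K : fieldType) (V W : lmodType K) (t : V ⊗ W) : W ⊗ V :=
  \tsum_(v ⊗ w <- t) w ⊗ v.

Section NijenhuisMockLie.
Variables (K : fieldType) (A : lmodType K).
Implicit Types (br : {bilinear A -> A -> A}) (Delta : {linear A -> (A ⊗ A)%type}).
Implicit Types (N S : {linear A -> A}) (r : A ⊗ A).

Definition mock_lie_algebra br : Prop :=
  (forall x y, br x y = br y x) /\
  (forall x y z, br x (br y z) + br y (br z x) + br z (br x y) = 0).

Definition nijenhuis_mock_lie_algebra br N : Prop :=
  mock_lie_algebra br /\
  (forall x y, br (N x) (N y) + N (N (br x y)) = N (br (N x) y) + N (br x (N y))).

Definition adjoint_admissible br N S : Prop :=
  forall x y, S (br (N x) y) + br x (S (S y)) = br (N x) (S y) + S (br x (S y)).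

(* A ⊗ A ⊗ A stands for A ⊗ (A ⊗ A). *)
Definition mock_lie_yang_baxter br r : Prop :=
  \tsum_(a ⊗ b <- r) \tsum_(a' ⊗ b' <- r)
    (br a a' ⊗ b ⊗ b' + a ⊗ a' ⊗ br b b' - a ⊗ br b a' ⊗ b') = 0.

Definition admissible_mock_lie_yang_baxter br N S r : Prop :=
  [/\ mock_lie_yang_baxter br r,
      tmap N idfun r - tmap idfun S r = 0
    & tmap S idfun r - tmap idfun N r = 0].

Definition antisymmetric_tensor r : Prop := r = - tflip r.

Definition mock_lie_coalgebra Delta : Prop :=
  (forall x, Delta x = tflip (Delta x)) /\
  (forall x,
      \tsum_(x1 ⊗ x2 <- Delta x) \tsum_(x21 ⊗ x22 <- Delta x2) x1 ⊗ x21 ⊗ x22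
    + \tsum_(x1 ⊗ x2 <- Delta x) \tsum_(x11 ⊗ x12 <- Delta x1) x11 ⊗ x12 ⊗ x2
    + \tsum_(x1 ⊗ x2 <- Delta x) \tsum_(x21 ⊗ x22 <- Delta x2) x21 ⊗ x1 ⊗ x22
    = 0).

Definition mock_lie_bialgebra br Delta : Prop :=
  [/\ mock_lie_algebra br,
      mock_lie_coalgebra Delta
    & forall x y, Delta (br x y) =
        - (\tsum_(y1 ⊗ y2 <- Delta y) br x y1 ⊗ y2)
        - (\tsum_(y1 ⊗ y2 <- Delta y) y1 ⊗ br x y2)
        - (\tsum_(x1 ⊗ x2 <- Delta x) br y x1 ⊗ x2)
        - (\tsum_(x1 ⊗ x2 <- Delta x) x1 ⊗ br y x2)].

Definition nijenhuis_mock_lie_coalgebra Delta S : Prop :=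
  mock_lie_coalgebra Delta /\
  (forall x, tmap S S (Delta x) + Delta (S (S x)) =
             tmap S idfun (Delta (S x)) + tmap idfun S (Delta (S x))).

Definition nijenhuis_mock_lie_bialgebra br Delta N S : Prop :=
  [/\ mock_lie_bialgebra br Delta,
      nijenhuis_mock_lie_algebra br N,
      adjoint_admissible br N S,
      nijenhuis_mock_lie_coalgebra Delta S
    & forall x, tmap S idfun (Delta (N x)) + tmap idfun (N \o N) (Delta x) =
                tmap S N (Delta x) + tmap idfun N (Delta (N x))].

Definition Delta_r br r (x : A) : A ⊗ A :=
  \tsum_(a ⊗ b <- r) (br x a ⊗ b - a ⊗ br x b).

Fact Delta_r_linear br r : linear (Delta_r br r).
Proof.
move=> c x y; rewrite /Delta_r -tliftP; congr (tlift _ r).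
apply/funext => a; apply/funext => b.
have brP z : br (c *: x + y) z = c *: br x z + br y z by exact: linearPl.
rewrite !brP (tpure_bilinear A A).1 (tpure_bilinear A A).2.
by rewrite scalerBr opprD addrACA.
Qed.

HB.instance Definition _ br r :=
  GRing.isLinear.Build K A (A ⊗ A)%type *:%R (Delta_r br r) (Delta_r_linear br r).

Definition coboundary_nijenhuis_mock_lie_bialgebra br Delta N S : Prop :=
  nijenhuis_mock_lie_bialgebra br Delta N S /\
  (exists r, Delta =1 Delta_r br r).

End NijenhuisMockLie.

(* Main.v *)
Require Import Defs.
From HB Require Import structures.
From mathcomp Require Import all_boot all_order all_algebra sesquilinear boolp.

Import GRing.Theory.
Local Open Scope ring_scope.

(** Write [L_x = br x] for the multiplication by [x] and [1] for the identity,
so that [Delta_r x = (L_x ⊗ 1 - 1 ⊗ L_x) r] ([Delta_rE]).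

- Bracket.  The Jacobi identity says that
  [L_[x,y] = - (L_x L_y + L_y L_x)]; expanding the compatibility of bracket
  and coproduct, the mixed terms [L_x ⊗ L_y] and [L_y ⊗ L_x] cancel
  ([Delta_r_cocycle]).  This holds for every [r].

- Coproduct.  Since the flip sends [r] to [- r], and exchanges [L_x ⊗ 1] with
  [1 ⊗ L_x], it fixes [Delta_r x] ([Delta_r_cocommutative]).  For the
  co-Jacobi identity, expand [(1 ⊗ Delta_r) Delta_r x].  The
  Yang-Baxter equation, multiplied by [x] in its first slot, merges two of the
  four terms, and antisymmetry turns the other two into the same shape.  What
  results is a sum of three tensors, each having one threefold bracket of
  [x, a_i, a_j] in one of the three slots and [b_i], [b_j] in the other two
  ([iterated_Delta_r_sum]).  The two other terms of the identity are
  permutations of this one by cocommutativity.  In the total, each slot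
  receives three brackets, which add up to zero by the Jacobi identity
  ([Delta_r_mock_lie_coalgebra]).

- Nijenhuis maps.  By the two linear conditions on [r], a map [S] acting
  directly on one slot of [r] may be traded for [N] on the other, and
  conversely ([tmap_slide]).  Both identities to be checked thereby take the
  form [(f ⊗ 1 - 1 ⊗ g) r = 0], where
  [f = 0] and [g = 0] are instances of the admissibility of [S] or of the
  Nijenhuis identity for [N] ([Delta_r_nijenhuis_coalgebra],
  [Delta_r_compatible]). *)

(** * Maps out of tensor products *)

Section TensorMaps.
Set Implicit Arguments.
Unset Strict Implicit.
Variable K : fieldType.

Section Tmap.
Variables (V V' W W' : lmodType K).

Lemma tpure_linear_bilinear (f : {linear V -> V'}) (g : {linear W -> W'}) :
  bilinear_for *:%R *:%R (fun v w => f v ⊗ g w).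
Proof.
by split=> [w a v v'|v a w w'] /=; rewrite linearP (linearPl, linearPr).
Qed.

Lemma tmap_sum (f : {linear V -> V'}) (g : {linear W -> W'}) (I : Type)
    (s : seq I) (v : I -> V) (w : I -> W) :
  tmap f g (\sum_(i <- s) v i ⊗ w i) = \sum_(i <- s) f (v i) ⊗ g (w i).
Proof. exact: tlift_sum (tpure_linear_bilinear f g) _ _ _ _. Qed.

Lemma tmapB (f : {linear V -> V'}) (g : {linear W -> W'}) (s t : V ⊗ W) :
  tmap f g (s - t) = tmap f g s - tmap f g t.
Proof.
pose h : {linear _ -> _} := HB.pack (tmap f g)
  (GRing.isLinear.Build _ _ _ _ _ (tlift_linear (tpure_linear_bilinear f g))).
exact: (linearB h).
Qed.

Lemma eq_tmapDl (f1 f2 f3 f4 : {linear V -> V'}) (g : {linear W -> W'}) t :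
  (forall v, f1 v + f2 v = f3 v + f4 v) ->
  tmap f1 g t + tmap f2 g t = tmap f3 g t + tmap f4 g t.
Proof.
move=> fE; have [s ->] := tensor_sum t.
rewrite !tmap_sum -!big_split; apply: eq_bigr => p _ /=.
by rewrite -!linearDl fE.
Qed.

Lemma eq_tmapDr (f : {linear V -> V'}) (g1 g2 g3 g4 : {linear W -> W'}) t :
  (forall w, g1 w + g2 w = g3 w + g4 w) ->
  tmap f g1 t + tmap f g2 t = tmap f g3 t + tmap f g4 t.
Proof.
move=> gE; have [s ->] := tensor_sum t.
rewrite !tmap_sum -!big_split; apply: eq_bigr => p _ /=.
by rewrite -!linearDr gE.
Qed.

End Tmap.

Lemma tmap_comp (V V' V'' W W' W'' : lmodType K)
    (f : {linear V -> V'}) (f' : {linear V' -> V''})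
    (g : {linear W -> W'}) (g' : {linear W' -> W''}) t :
  tmap f' g' (tmap f g t) = tmap (f' \o f) (g' \o g) t.
Proof. by have [s ->] := tensor_sum t; rewrite !tmap_sum. Qed.

Section Tlift.
Variables (V W U : lmodType K).

Lemma tliftB (f : V -> W -> U) (s t : V ⊗ W) : bilinear_for *:%R *:%R f ->
  tlift f (s - t) = tlift f s - tlift f t.
Proof.
move=> fbil; pose h : {linear _ -> _} :=
  HB.pack (tlift f) (GRing.isLinear.Build _ _ _ _ _ (tlift_linear fbil)).
exact: (linearB h).
Qed.

Lemma tliftN (f : V -> W -> U) (t : V ⊗ W) : bilinear_for *:%R *:%R f ->
  tlift f (- t) = - tlift f t.
Proof.
by move=> fbil; rewrite -[- t]add0r -(subrr t) !tliftB // subrr sub0r.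
Qed.

(** A family of functions that is linear in a parameter has a lift linear in
that parameter, because [tlift] is linear in the function being lifted; this
is what makes nested [\tsum] expressions multilinear. *)
Lemma tlift_param_linear (X : lmodType K) (g : X -> V -> W -> U) (t : V ⊗ W) :
  (forall v w, linear (fun x => g x v w)) -> linear (fun x => tlift (g x) t).
Proof.
move=> glin k x x'; rewrite -tliftP; congr (tlift _ t).
by apply/funext => v; apply/funext => w; apply: glin.
Qed.

End Tlift.

Lemma tlift2_sum (V W V' W' U : lmodType K) (g : V -> W -> V' -> W' -> U)
    (s : seq (V * W)) (s' : seq (V' * W')) :
  (forall v' w', bilinear_for *:%R *:%R (fun v w => g v w v' w')) ->
  (forall v w, bilinear_for *:%R *:%R (g v w)) ->
  tlift (fun v w => tlift (g v w) (\sum_(q <- s') q.1 ⊗ q.2))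
    (\sum_(p <- s) p.1 ⊗ p.2) =
  \sum_(p <- s) \sum_(q <- s') g p.1 p.2 q.1 q.2.
Proof.
move=> gbil gbil'; rewrite tlift_sum; first by apply: eq_bigr => p _; apply: tlift_sum.
split=> [w|v]; apply: tlift_param_linear => v' w'.
  exact: (gbil v' w').1.
exact: (gbil v' w').2.
Qed.

Lemma tpure_flip_bilinear (V W : lmodType K) :
  bilinear_for *:%R *:%R (fun (v : V) (w : W) => w ⊗ v).
Proof. by split=> [w|v] k u u'; rewrite (linearPl, linearPr). Qed.

Lemma tlift_flip (V W U : lmodType K) (f : W -> V -> U) (t : V ⊗ W) :
  bilinear_for *:%R *:%R f ->
  tlift f (tflip t) = \tsum_(v ⊗ w <- t) f w v.
Proof.
move=> fbil; have [s ->] := tensor_sum t.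
rewrite /tflip (tlift_sum (tpure_flip_bilinear V W)) !tlift_sum //.
by split=> [w|v] k u u'; [apply: fbil.2|apply: fbil.1].
Qed.

End TensorMaps.

(** * The coproduct of an antisymmetric solution *)

Section Coboundary.
Set Implicit Arguments.
Unset Strict Implicit.
Variables (K : fieldType) (A : lmodType K) (br : {bilinear A -> A -> A}).
Implicit Types (x y z : A) (r : (A ⊗ A)%type) (N S : {linear A -> A}).

Lemma Delta_r_bilinear x :
  bilinear_for *:%R *:%R (fun a b => br x a ⊗ b - a ⊗ br x b).
Proof.
by split=> [w a v v'|v a w w'] /=;
  rewrite !(linearPl, linearPr) scalerBr opprD addrACA.
Qed.

Lemma Delta_rE r x :
  Delta_r br r x = tmap (br x) idfun r - tmap idfun (br x) r.
Proof.
have [s ->] := tensor_sum r; rewrite !tmap_sum -sumrB.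
exact: tlift_sum (Delta_r_bilinear x) _ _ _ _.
Qed.

(* A decomposition of [r] into pure tensors, as in the notation [a_i ⊗ b_i],
   turns nested lifts into double sums, whose order can be exchanged. *)
Section Antisymmetric.
Variable s : seq (A * A).
Let r : A ⊗ A := \sum_(p <- s) p.1 ⊗ p.2.
Hypothesis r_anti : antisymmetric_tensor r.

Lemma tlift_Delta_r (U : lmodType K) (f : A -> A -> U) x :
  bilinear_for *:%R *:%R f ->
  tlift f (Delta_r br r x) =
  \sum_(p <- s) (f (br x p.1) p.2 - f p.1 (br x p.2)).
Proof.
by move=> fbil; rewrite Delta_rE tliftB // !tmap_sum !tlift_sum // sumrB.
Qed.

Lemma tflipE : tflip r = \sum_(p <- s) p.2 ⊗ p.1.
Proof.
exact: tlift_sum (tpure_flip_bilinear A A) _ _ _ _.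
Qed.

Lemma antisymmetric_sum (U : lmodType K) (f : A -> A -> U) :
  bilinear_for *:%R *:%R f ->
  \sum_(p <- s) f p.1 p.2 = - \sum_(p <- s) f p.2 p.1.
Proof.
move=> fbil; rewrite -(tlift_sum fbil) -/r r_anti tliftN // tflipE.
by rewrite (tlift_sum fbil).
Qed.

Definition trilinear (U : lmodType K) (g : A -> A -> A -> U) : Prop :=
  [/\ forall b c, linear (fun a => g a b c),
      forall a c, linear (fun b => g a b c)
    & forall a b, linear (g a b)].

Lemma trilinear_lift (U : lmodType K) (g : A -> A -> A -> U) :
  trilinear g -> bilinear_for *:%R *:%R (fun a (t : A ⊗ A) => tlift (g a) t).
Proof.
move=> [g1 g2 g3]; split=> [t|a]; first exact: tlift_param_linear.
by apply: tlift_linear; split=> [c|b]; [apply: g2|apply: g3].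
Qed.

(** The Yang-Baxter equation holds in the threefold tensor product, so it can be
pushed forward by any linear map out of it, that is, by any trilinear [g].
This gives the equation multiplied by [x] in one slot, for instance. *)
Lemma mock_lie_yang_baxter_sum (U : lmodType K) (g : A -> A -> A -> U) :
  mock_lie_yang_baxter br r -> trilinear g ->
  \sum_(p <- s) \sum_(q <- s) (g (br p.1 q.1) p.2 q.2
    + g p.1 q.1 (br p.2 q.2) - g p.1 (br p.2 q.1) q.2) = 0.
Proof.
move=> ybe gtri; have gbil := trilinear_lift gtri.
have g'bil a : bilinear_for *:%R *:%R (g a).
  by case: gtri => g1 g2 g3; split=> [c|b]; [apply: g2|apply: g3].
pose h : {linear (A ⊗ (A ⊗ A))%type -> U} :=
  HB.pack (tlift (fun a (t : A ⊗ A) => tlift (g a) t))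
    (GRing.isLinear.Build _ _ _ _ _ (tlift_linear gbil)).
have hE a b c : h (a ⊗ b ⊗ c) = g a b c by rewrite /= !tlift_pure.
transitivity (h 0); last exact: linear0.
rewrite -{}ybe (tlift2_sum (g := fun a b a' b' =>
  br a a' ⊗ b ⊗ b' + a ⊗ a' ⊗ br b b' - a ⊗ br b a' ⊗ b')).
- rewrite linear_sum; apply: eq_bigr => p _.
  rewrite linear_sum; apply: eq_bigr => q _.
  by rewrite linearB linearD !hE.
- move=> a' b'; split=> [b k a1 a2|a k b1 b2] /=;
  rewrite !(linearPl, linearPr) !scalerBr !scalerDr opprD;
  by rewrite [in RHS]addrACA; congr (_ + _); rewrite addrACA.
- move=> a b; split=> [b' k a1 a2|a' k b1 b2] /=;
  rewrite !(linearPl, linearPr) !scalerBr !scalerDr opprD;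
  by rewrite [in RHS]addrACA; congr (_ + _); rewrite addrACA.
Qed.

(** The normal form of [(1 ⊗ Delta_r) Delta_r x]: after use of antisymmetry,
only the [b_i] stand outside of the brackets, so that terms coming from
different permutations of the slots can be compared.  The arbitrary [g]
accounts for these permutations. *)
Lemma iterated_Delta_r_sum (U : lmodType K) (g : A -> A -> A -> U) x :
  mock_lie_yang_baxter br r -> trilinear g ->
  \tsum_(x1 ⊗ x2 <- Delta_r br r x) \tsum_(y1 ⊗ y2 <- Delta_r br r x2)
    g x1 y1 y2 =
  \sum_(p <- s) \sum_(q <- s) (g (br x (br p.1 q.1)) p.2 q.2
    + g p.2 (br (br x p.1) q.1) q.2 + g p.2 q.2 (br (br x p.1) q.1)).
Proof.
move=> ybe gtri; have gbil := trilinear_lift gtri.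
have [g1 g2 g3] := gtri.
have g'bil a : bilinear_for *:%R *:%R (g a).
  by split=> [c|b]; [apply: g2|apply: g3].
rewrite (tlift_Delta_r (f := fun x1 x2 =>
  tlift (fun y1 y2 => g x1 y1 y2) (Delta_r br r x2))); last first.
  split=> [b|a] k c1 c2 /=; first by rewrite gbil.1.
  by rewrite linearP gbil.2.
under eq_bigr do rewrite !tlift_Delta_r //.
have brx_tri : trilinear (fun a b c => g (br x a) b c).
  by split=> [b c k a a'|a c|a b] //; rewrite linearPr; apply: g1.
(* The Yang-Baxter equation with its first slot multiplied by [x]. *)
have ybeE : \sum_(p <- s) \sum_(q <- s)
      (g (br x p.1) (br p.2 q.1) q.2 - g (br x p.1) q.1 (br p.2 q.2)) =
    \sum_(p <- s) \sum_(q <- s) g (br x (br p.1 q.1)) p.2 q.2.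
  apply/esym/eqP; rewrite -subr_eq0 -sumrB; apply/eqP.
  rewrite -[RHS](mock_lie_yang_baxter_sum ybe brx_tri).
  apply: eq_bigr => p _; rewrite -sumrB; apply: eq_bigr => q _.
  by rewrite opprB addrA.
(* Antisymmetry of the [p]-factor for fixed [q]. *)
have anti2 : \sum_(p <- s) \sum_(q <- s) g p.1 (br (br x p.2) q.1) q.2 =
    - \sum_(p <- s) \sum_(q <- s) g p.2 (br (br x p.1) q.1) q.2.
  rewrite exchange_big [in RHS]exchange_big -sumrN; apply: eq_bigr => q _.
  apply: (antisymmetric_sum (f := fun a b => g a (br (br x b) q.1) q.2)).
  split=> [b|a] k c c' /=; first exact: g1.
  by rewrite linearPr linearPl; apply: g2.
(* Antisymmetry of the [q]-factor, then of the [p]-factor: the signs cancel. *)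
have anti3 : \sum_(p <- s) \sum_(q <- s) g p.1 q.1 (br (br x p.2) q.2) =
    \sum_(p <- s) \sum_(q <- s) g p.2 q.2 (br (br x p.1) q.1).
  transitivity (- \sum_(p <- s) \sum_(q <- s) g p.1 q.2 (br (br x p.2) q.1)).
    rewrite -sumrN; apply: eq_bigr => p _.
    apply: (antisymmetric_sum (f := fun a b => g p.1 a (br (br x p.2) b))).
    split=> [b|a] k c c' /=; first exact: g2.
    by rewrite linearPr; apply: g3.
  rewrite exchange_big [in RHS]exchange_big -sumrN; apply: eq_bigr => q _ /=.
  rewrite -[RHS]opprK; congr (- _).
  apply: (antisymmetric_sum (f := fun a b => g a q.2 (br (br x b) q.1))).
  split=> [b|a] k c c' /=; first exact: g1.
  by rewrite linearPr linearPl; apply: g3.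
rewrite sumrB ybeE; under [X in _ - X]eq_bigr do rewrite sumrB.
rewrite sumrB anti2 anti3 opprD !opprK addrA -!big_split.
by apply: eq_bigr => p _; rewrite -!big_split.
Qed.

Lemma Delta_r_cocommutative x : Delta_r br r x = tflip (Delta_r br r x).
Proof.
have flip_bil := tpure_flip_bilinear A A.
have Delta_bil := Delta_r_bilinear x.
rewrite [RHS](tlift_Delta_r (f := fun a b => b ⊗ a)) // /Delta_r /r tlift_sum //.
rewrite (antisymmetric_sum Delta_bil) -sumrN.
by apply: eq_bigr => p _; rewrite opprB.
Qed.

(** Gathering the terms slot by slot, what multiplies [b_i ⊗ b_j] is
[[x, [a_i, a_j]] + [[x, a_j], a_i] + [[x, a_i], a_j]], which vanishes by the
Jacobi identity. *)
Lemma Delta_r_mock_lie_coalgebra :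
  mock_lie_algebra br -> mock_lie_yang_baxter br r ->
  mock_lie_coalgebra (Delta_r br r).
Proof.
move=> [brC jacobi] ybe; split=> [|x]; first exact: Delta_r_cocommutative.
have tri1 : trilinear (fun a b c : A => a ⊗ b ⊗ c).
  by split=> *; move=> k u u'; rewrite !(linearPl, linearPr).
have tri2 : trilinear (fun a b c : A => b ⊗ c ⊗ a).
  by split=> *; move=> k u u'; rewrite !(linearPl, linearPr).
have tri3 : trilinear (fun a b c : A => b ⊗ a ⊗ c).
  by split=> *; move=> k u u'; rewrite !(linearPl, linearPr).
(* Cocommutativity turns the second term into the iterated coproduct
   [x1 ⊗ x21 ⊗ x22] with its slots permuted cyclically. *)
have -> : \tsum_(x1 ⊗ x2 <- Delta_r br r x)
    \tsum_(x11 ⊗ x12 <- Delta_r br r x1) x11 ⊗ x12 ⊗ x2 =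
  \tsum_(x1 ⊗ x2 <- Delta_r br r x)
    \tsum_(x21 ⊗ x22 <- Delta_r br r x2) x21 ⊗ x22 ⊗ x1.
  have bil2 := trilinear_lift tri2.
  rewrite [in LHS]Delta_r_cocommutative tlift_flip //.
  split=> [b|a] k u u' /=; last exact: bil2.1.
  by rewrite linearP; apply: bil2.2.
rewrite (iterated_Delta_r_sum x ybe tri1) (iterated_Delta_r_sum x ybe tri2).
rewrite (iterated_Delta_r_sum x ybe tri3).
have split3 (F G H : A * A -> A * A -> (A ⊗ A ⊗ A)%type) :
    \sum_(p <- s) \sum_(q <- s) (F p q + G p q + H p q) =
    \sum_(p <- s) \sum_(q <- s) F p q + \sum_(p <- s) \sum_(q <- s) G p q +
    \sum_(p <- s) \sum_(q <- s) H p q.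
  by rewrite -!big_split; apply: eq_bigr => p _; rewrite -!big_split.
(* Exchanging [p] and [q] in the middle sum brings the [b]-factors of the three
   sums in the same order. *)
have jacobi_sum (F : A -> A -> A -> (A ⊗ A ⊗ A)%type) :
    (forall b c, linear (F b c)) ->
    \sum_(p <- s) \sum_(q <- s) F p.2 q.2 (br x (br p.1 q.1)) +
    \sum_(p <- s) \sum_(q <- s) F q.2 p.2 (br (br x p.1) q.1) +
    \sum_(p <- s) \sum_(q <- s) F p.2 q.2 (br (br x p.1) q.1) = 0.
  move=> Flin; rewrite [X in _ + X + _]exchange_big -!big_split big1 // => p _ /=.
  rewrite -!big_split big1 // => q _ /=.
  pose h : {linear _ -> _} := HB.pack (F p.2 q.2)
    (GRing.isLinear.Build _ _ _ _ _ (Flin p.2 q.2)).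
  rewrite -![F _ _ _]/(h _) -!linearD.
  rewrite (brC (br x q.1)) (brC x q.1) (brC (br x p.1)) jacobi.
  exact: linear0.
rewrite !split3.
(* One block for each position at which the threefold bracket occurs. *)
rewrite [LHS](AC (3*3*3) ((1*5*8)*(7*6*2)*(4*9*3))) /=.
rewrite (jacobi_sum (fun b c a => a ⊗ b ⊗ c)); last by case: tri1.
rewrite (jacobi_sum (fun b c a => b ⊗ a ⊗ c)); last by case: tri1.
rewrite (jacobi_sum (fun b c a => b ⊗ c ⊗ a)); last by case: tri1.
by rewrite !addr0.
Qed.

End Antisymmetric.

(** * Compatibility with the bracket *)

Section Bialgebra.
Variable r : A ⊗ A.

(** In terms of operators on [r], the right-hand side is
[- (L_x ⊗ 1 + 1 ⊗ L_x) (L_y ⊗ 1 - 1 ⊗ L_y)] plus the same with [x] and [y]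
exchanged; the mixed terms cancel, and the others add up to
[L_[x,y] ⊗ 1 - 1 ⊗ L_[x,y]] by the Jacobi identity. *)
Lemma Delta_r_cocycle : mock_lie_algebra br -> forall x y,
  Delta_r br r (br x y) = - tmap (br x) idfun (Delta_r br r y)
    - tmap idfun (br x) (Delta_r br r y) - tmap (br y) idfun (Delta_r br r x)
    - tmap idfun (br y) (Delta_r br r x).
Proof.
move=> [brC jacobi] x y.
have brbr z : br (br x y) z = - (br x (br y z) + br y (br x z)).
  apply/eqP; rewrite -addr_eq0 addrC (brC (br x y)) (brC x z); apply/eqP.
  exact: jacobi.
rewrite !Delta_rE !tmapB !tmap_comp; have [s ->] := tensor_sum r.
rewrite !tmap_sum -!sumrB -!sumrN -!big_split; apply: eq_bigr => -[a b] _ /=.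
rewrite !brbr linearNl linearDl linearNr linearDr opprK opprD !opprB.
rewrite -[X in _ = X + _]addrA (subrKA (br y a ⊗ br x b)).
rewrite [RHS]addrC [in RHS]addrA (subrKA (br x a ⊗ br y b)).
by rewrite [RHS]addrACA [LHS]addrC [X in X + _ = _]addrC.
Qed.

End Bialgebra.

(** * Compatibility with the Nijenhuis maps *)

Section Nijenhuis.
Variables (N S : {linear A -> A}) (r : A ⊗ A).
Hypotheses (rNS : tmap N idfun r - tmap idfun S r = 0).
Hypotheses (rSN : tmap S idfun r - tmap idfun N r = 0).
Hypotheses (brC : forall x y, br x y = br y x).
Hypotheses (adm : adjoint_admissible br N S).

(** The two linear conditions on [r] are the cases [(P, Q) = (N, S)] and
[(P, Q) = (S, N)]: a map can be moved to the other slot of [r], where it is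
applied first. *)
Lemma tmap_slide (P Q f g : {linear A -> A}) :
  tmap P idfun r - tmap idfun Q r = 0 ->
  tmap f (g \o Q) r = tmap (f \o P) g r.
Proof.
move=> /subr0_eq rPQ.
by rewrite -[RHS](tmap_comp P f idfun g) rPQ tmap_comp.
Qed.

(** Once the right-hand factors are moved, the first slot carries
[S L_x N + L_(S^2 x) = S L_(S x) + L_(S x) N], and so does the second. By
commutativity of the bracket, this is the admissibility of [S] with the roles
of its two arguments exchanged. *)
Lemma Delta_r_nijenhuis_coalgebra x :
  tmap S S (Delta_r br r x) + Delta_r br r (S (S x)) =
  tmap S idfun (Delta_r br r (S x)) + tmap idfun S (Delta_r br r (S x)).
Proof.
have e1 : tmap S S (tmap (br x) idfun r) = tmap (S \o br x \o N) idfun r.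
  by rewrite tmap_comp; apply: (tmap_slide _ idfun).
have e2 : tmap S S (tmap idfun (br x) r) = tmap idfun (S \o br x \o N) r.
  by rewrite tmap_comp; apply/esym/(tmap_slide idfun).
have e3 : tmap S idfun (tmap idfun (br (S x)) r) =
    tmap idfun (br (S x) \o N) r.
  by rewrite tmap_comp; apply/esym/(tmap_slide idfun).
have e4 : tmap idfun S (tmap (br (S x)) idfun r) =
    tmap (br (S x) \o N) idfun r.
  by rewrite tmap_comp; apply: (tmap_slide _ idfun).
have adm_x a : S (br x (N a)) + br (S (S x)) a =
    S (br (S x) a) + br (S x) (N a).
  by rewrite ![br _ a]brC addrC [RHS]addrC ![br _ (N a)]brC [LHS]addrC adm.
rewrite !Delta_rE !tmapB e1 e2 e3 e4 !tmap_comp.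
rewrite addrACA -opprD [in RHS]addrACA -opprD; congr (_ - _).
  exact: eq_tmapDl.
by apply: eq_tmapDr => a; rewrite [RHS]addrC; apply: adm_x.
Qed.

(** Here the two slots carry different identities: admissibility of [S] in the
first, the Nijenhuis identity of [N] in the second. *)
Lemma Delta_r_compatible x :
  (forall x y, br (N x) (N y) + N (N (br x y)) = N (br (N x) y) + N (br x (N y))) ->
  tmap S idfun (Delta_r br r (N x)) + tmap idfun (N \o N) (Delta_r br r x) =
  tmap S N (Delta_r br r x) + tmap idfun N (Delta_r br r (N x)).
Proof.
move=> nij.
have e1 : tmap S idfun (tmap idfun (br (N x)) r) =
    tmap idfun (br (N x) \o N) r.
  by rewrite tmap_comp; apply/esym/(tmap_slide idfun).
have e2 : tmap idfun (N \o N) (tmap (br x) idfun r) =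
    tmap (br x \o S \o S) idfun r.
  rewrite tmap_comp -(tmap_slide _ idfun rSN).
  by rewrite -(tmap_slide _ (idfun \o N) rSN).
have e3 : tmap S N (tmap (br x) idfun r) = tmap (S \o br x \o S) idfun r.
  by rewrite tmap_comp; apply: (tmap_slide _ idfun).
have e4 : tmap S N (tmap idfun (br x) r) = tmap idfun (N \o br x \o N) r.
  by rewrite tmap_comp; apply/esym/(tmap_slide idfun).
have e5 : tmap idfun N (tmap (br (N x)) idfun r) =
    tmap (br (N x) \o S) idfun r.
  by rewrite tmap_comp; apply: (tmap_slide _ idfun).
rewrite !Delta_rE !tmapB e1 e2 e3 e4 e5 !tmap_comp.
rewrite addrACA -opprD [in RHS]addrACA -opprD; congr (_ - _).
  by apply: eq_tmapDl => a /=; rewrite adm addrC.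
by apply: eq_tmapDr => a /=; rewrite nij addrC.
Qed.

End Nijenhuis.
End Coboundary.

Theorem proposition4p22 (K : fieldType) (char0 : [pchar K] =i pred0)
  (A : lmodType K) (br : {bilinear A -> A -> A}) (N S : {linear A -> A})
  (r : (A ⊗ A)%type) :
  nijenhuis_mock_lie_algebra br N ->
  adjoint_admissible br N S ->
  antisymmetric_tensor r ->
  admissible_mock_lie_yang_baxter br N S r ->
  coboundary_nijenhuis_mock_lie_bialgebra br (Delta_r br r) N S.
Proof.
move=> [mock nij] adm r_anti [ybe rNS rSN].
have coalg : mock_lie_coalgebra (Delta_r br r).
  have [s rE] := tensor_sum r; rewrite rE in r_anti ybe *.
  exact: Delta_r_mock_lie_coalgebra.
split; last by exists r.
split=> //.
- by split=> //; apply: Delta_r_cocycle.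
- by split=> // x; apply: Delta_r_nijenhuis_coalgebra (proj1 mock) adm x.
- by move=> x; apply: Delta_r_compatible.
Qed.
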